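(* Let $(X,\|\cdot\|)$ be an infinite-dimensional Fréchet space and let $\mathcal{V}=\{V_n\}_{n\in\mathbb{N}}$ be a nested sequence of linear subspaces of $X$ such that $\overline{V_n}\subseteq V_{n+1}$ for every $n\in\mathbb{N}$ and $X=\overline{\bigcup_{n=1}^{\infty}V_n}$. Let $\{e_n\}_{n\in\mathbb{N}}$ be a decreasing sequence of positive numbers tending to $0$. Assume that $$d_{\mathcal{V}}=\inf\{d_{n,\mathcal{V}}: n\in\mathbb{N}\}>0.$$ Then there exist $n_o\in\mathbb{N}$ and $x\in X$ such that for every $n\geq n_o$ $$\frac{e_n}{3}\leq \mathrm{dist}(x,V_n)\leq 3e_n.$$
   Context: $\mathbb{N}=\{1,2,\dots\}$. A Fréchet space $(X,\|\cdot\|)$ is a (real or complex) metric linear space which is complete with respect to an F-norm $\|\cdot\|$ giving its topology; an F-norm satisfies $\|x\|=0$ iff $x=0$, $\|\alpha x\|=\|x\|$ for all scalars with $|\alpha|=1$, and $\|x+y\|\leq\|x\|+\|y\|$ (no local convexity is assumed; scalar multiplication is continuous). Closures are taken with respect to $\|\cdot\|$. For $x\in X$ and $V\subseteq X$, $\mathrm{dist}(x,V)=\inf\{\|x-v\|:v\in V\}$. Put $\rho_n(x)=\mathrm{dist}(x,V_n)$ and $d_{n,\mathcal{V}}=\sup\{\rho_n(v):v\in V_{n+1}\}\in[0,\infty]$. *)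

(* Defs.v *)
From HB Require Import structures.
From mathcomp Require Import all_boot all_order all_algebra.
From mathcomp Require Import all_classical all_reals all_analysis.
From mathcomp Require Import complex.

Set Implicit Arguments.
Unset Strict Implicit.
Unset Printing Implicit Defensive.

Import Order.TTheory GRing.Theory Num.Theory.
Import numFieldNormedType.Exports.

Local Open Scope classical_set_scope.
Local Open Scope ring_scope.

Variant scalar_kind := RealScalars | ComplexScalars.

Definition scalars (R : realType) (k : scalar_kind) : numFieldType :=
  match k with RealScalars => R | ComplexScalars => R[i] end.

Section Frechet.
Context {R : realType} {K : numFieldType}.

(* Nonnegativity follows: 0 = N 0 <= N x + N (- x) = 2 * N x. *)
Record fnorm (X : lmodType K) (N : X -> R) : Prop := Fnorm {
  fnorm_eq0 : forall x, N x = 0 <-> x = 0;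
  fnorm_unimodular : forall (a : K) x, `|a| = 1 -> N (a *: x) = N x;
  fnorm_triangle : forall x y, N (x + y) <= N x + N y }.

(* The linear structure is continuous because [X] is a [topologicalLmodType];
   nothing is assumed about local convexity, so [X] is not a [tvsType]. *)
Record frechet_space (X : topologicalLmodType K) (N : X -> R) : Prop := Frechet {
  frechet_fnorm : fnorm N;
  frechet_topology : forall (x : X) (A : set X),
    nbhs x A <-> exists2 r : R, 0 < r & [set y | N (x - y) < r] `<=` A;
  frechet_complete : forall u : nat -> X,
    (forall r : R, 0 < r ->
       exists m, forall i j, (m <= i)%N -> (m <= j)%N -> N (u i - u j) < r) ->
    exists l : X, u @ \oo --> l }.

Definition infinite_dimensional (X : lmodType K) : Prop :=
  ~ exists (n : nat) (b : 'I_n -> X),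
      forall x, exists c : 'I_n -> K, x = \sum_(i < n) c i *: b i.

(* A real infimum is enough: for N an F-norm and V nonempty (a linear subspace),
   the set of values is nonempty and bounded below by 0. *)
Definition dist (X : lmodType K) (N : X -> R) (x : X) (V : set X) : R :=
  inf [set N (x - v) | v in V].

(* The supremum may be infinite, hence the extended reals. Sequences are indexed
   from 0, so [V 0] is the first subspace of the family. *)
Definition deviation (X : lmodType K) (N : X -> R) (V : nat -> set X) (n : nat) :
    \bar R :=
  ereal_sup [set (dist N v (V n))%:E | v in V n.+1].

End Frechet.

(* Main.v *)
Require Import Defs.
From HB Require Import structures.
From mathcomp Require Import all_boot all_order all_algebra.
From mathcomp Require Import all_classical all_reals all_analysis.
From mathcomp Require Import complex.
From mathcomp Require Import lra.

Import Order.TTheory GRing.Theory Num.Theory.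
Import numFieldNormedType.Exports.

Local Open Scope classical_set_scope.
Local Open Scope ring_scope.

(** Cut the index set into blocks [n_k, n_(k+1)[, where n_(k+1) is the first
    index at which e has dropped to a quarter of e (n_k) or less.  Inside a
    block e varies by a factor less than 4, and from one block to the next the
    values e (n_k) decrease at least geometrically with ratio 1/4.  Since
    dist(x, V_j) is nonincreasing in j, the two bounds need only be secured at
    the ends of each block: the upper bound at its first index, against the
    smallest value of e there, and the lower bound at its last index, against
    the largest value of e.

    The vector is a series x = sum_k x_k with one term per block.  The term x_k
    lies in V_(n_(k+1)), is at distance at least a_k from the preceding
    subspace V_(n_(k+1) - 1), and has F-norm less than mu_k, for a prescribed
    mu_k slightly larger than a_k ([near_extremal_vector]).  Such a vector
    exists as soon as a_k is below all the deviations; as a_k is proportional to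
    e (n_k), this fixes the initial index.  The sum x_0 + ... + x_(k-1) lies in
    V_(n_k), so in the k-th block only the tail from x_k on matters, and its
    F-norm is at most 4/3 mu_k ([rapid_series_cvg], which uses completeness).
    At the end of the block x_k dominates: the tail after it has F-norm at most
    4/3 mu_(k+1), hence at most mu_k / 3.

    With a_k = 25/48 e (n_k) and mu_k = 27/48 e (n_k) both bounds close:
    4/3 * 27/48 = 3/4, and 3/4 e (n_k) < 3 e_j for every j in the block, while
    25/48 - 1/3 * 27/48 = 1/3, and e (n_k) >= e_j. *)

(** * Distance to a subspace for an F-norm *)

Section Distance.
Set Implicit Arguments.
Unset Strict Implicit.
Context {R : realType} {K : numFieldType} {X : lmodType K} {N : X -> R}.
Context (fN : fnorm N).
Implicit Types (x y v s : X) (V W : set X).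

Lemma fnorm0 : N 0 = 0.
Proof. by apply/(fnorm_eq0 fN). Qed.

Lemma fnormN x : N (- x) = N x.
Proof. by rewrite -scaleN1r (fnorm_unimodular fN)// normrN1. Qed.

Lemma fnorm_ge0 x : 0 <= N x.
Proof.
have := fnorm_triangle fN x (- x); rewrite subrr fnorm0 fnormN; lra.
Qed.

Lemma distances_has_lbound x V : has_lbound [set N (x - v) | v in V].
Proof. by exists 0 => _ [v _ <-]; exact: fnorm_ge0. Qed.

Lemma dist_le x v V : V v -> dist N x V <= N (x - v).
Proof.
by move=> Vv; apply: ge_inf; [exact: distances_has_lbound | exists v].
Qed.

Lemma dist_ge x V (r : R) :
  V !=set0 -> (forall v, V v -> r <= N (x - v)) -> r <= dist N x V.
Proof.
move=> [v0 Vv0] rle; apply: lb_le_inf; first by exists (N (x - v0)); exists v0.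
by move=> _ [v Vv <-]; exact: rle.
Qed.

Lemma dist_lt_witness x V (r : R) :
  V !=set0 -> dist N x V < r -> exists2 v, V v & N (x - v) < r.
Proof.
move=> V0 dr; apply: contrapT => nv; move: dr; apply/negP; rewrite -leNgt.
apply: dist_ge => // v Vv; rewrite leNgt; apply/negP => lt; apply: nv.
by exists v.
Qed.

Lemma dist_antitone x V W : V !=set0 -> V `<=` W -> dist N x W <= dist N x V.
Proof. by move=> V0 VW; apply: dist_ge => // v /VW; exact: dist_le. Qed.

(** As v ranges over V, the last term measures x - y in the quotient X / V:
    vectors of V may be added freely when two distances are compared. *)
Lemma dist_lipschitz_mod x y v V : submod_closed (mem V) -> V v ->
  dist N x V <= dist N y V + N (x - v - y).
Proof.
move=> [V0 Vlin] Vv; rewrite -lerBlDr; apply: dist_ge.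
  by exists 0; move: V0; rewrite inE.
move=> w Vw; rewrite lerBlDr.
have Vvw : V (v + w).
  by have := Vlin 1 v w; rewrite !inE scale1r; apply.
apply: (le_trans (dist_le x Vvw)).
suff -> : x - (v + w) = (y - w) + (x - v - y) by exact: (fnorm_triangle fN).
by rewrite [RHS]addrC subrKA opprD addrA.
Qed.

(** Without local convexity, or even monotonicity of N along rays, a vector
    cannot be rescaled to a prescribed distance.  Moving from 0 to v in equal
    steps v / (n + 1), of F-norm below the tolerance, the distance to V cannot
    jump over the window from a to b; the first point at distance at least a
    from V is then corrected by a nearly best approximation in V. *)
Lemma near_extremal_vector V W (a b : R) v :
    submod_closed (mem V) -> submod_closed (mem W) -> V `<=` W ->
    (forall d : R, 0 < d -> exists n, N (n.+1%:R^-1 *: v) < d) ->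
    0 < a -> a < b -> W v -> a < dist N v V ->
  exists x, [/\ W x, a <= dist N x V & N x < b].
Proof.
move=> sV [W0 Wlin] VW small a0 ab Wv av.
have VO : V 0 by case: sV => V0 _; move: V0; rewrite inE.
have [n Ns] := small (b - a) ltac:(by rewrite subr_gt0).
set s := _ *: v in Ns.
have sn : s *+ n.+1 = v.
  by rewrite -scaler_nat scalerA mulfV ?scale1r// pnatr_eq0.
have Ws k : W (s *+ k).
  have := Wlin (k%:R * n.+1%:R^-1) v 0.
  by rewrite !inE addr0 -scalerA scaler_nat; apply=> //; rewrite inE in W0.
have ex : exists k, a <= dist N (s *+ k) V by exists n.+1; rewrite sn ltW.
case: (ex_minnP ex) => -[|k] ak mink.
  (* The first such index is not 0, since dist(0, V) <= N 0 = 0 < a. *)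
  have := dist_le 0 VO; rewrite subr0 fnorm0 => /(le_trans ak).
  by rewrite leNgt a0.
have ska : dist N (s *+ k) V < a.
  by rewrite ltNge; apply/negP => /mink; rewrite ltnn.
have skb : dist N (s *+ k.+1) V < b.
  have := @dist_lipschitz_mod (s *+ k.+1) (s *+ k) 0 V sV VO.
  rewrite subr0 mulrS addrK; lra.
have [u Vu ub] := dist_lt_witness (ex_intro _ _ VO) skb.
exists (s *+ k.+1 - u); split=> //.
  have := Wlin (-1) u (s *+ k.+1).
  by rewrite !inE scaleN1r addrC; apply; [exact: VW | exact: Ws].
apply: (le_trans ak).
have := @dist_lipschitz_mod (s *+ k.+1) (s *+ k.+1 - u) u V sV Vu.
by rewrite subrr fnorm0 addr0.
Qed.

End Distance.

(** * Small multiples of a vector *)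

(** A numeric field need not be archimedean, so the two kinds of scalars are
    inspected; a complex number that is positive is a positive real. *)
Lemma scalars_archimedean {R : realType} {k : scalar_kind} (d : scalars R k) :
  0 < d -> exists n, n.+1%:R^-1 < d.
Proof.
have arch (r : R) : 0 < r -> exists n, n.+1%:R^-1 < r.
  move=> r0; have [n _ /(_ n (leqnn n))] := near_infty_natSinv_lt (PosNum r0).
  by exists n.
case: k d => [|[x y]] /=; first exact: arch.
rewrite ltcE/= => /andP[/eqP y0 /arch [n nx]]; exists n.
by rewrite -(rmorph_nat (real_complex R)) -fmorphV ltcE/= y0 eqxx.
Qed.

Lemma fnorm_small_multiple {R : realType} {k : scalar_kind}
    {X : topologicalLmodType (scalars R k)} {N : X -> R} (v : X) (d : R) :
  frechet_space N -> 0 < d -> exists n, N (n.+1%:R^-1 *: v) < d.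
Proof.
move=> FN d0; have fN := frechet_fnorm FN.
have : nbhs (0 *: v : X) [set y | N y < d].
  rewrite scale0r; apply/(frechet_topology FN); exists d => // y /=.
  by rewrite sub0r (fnormN fN).
move=> nb.
have := @scale_continuous _ X (0, v) _ nb.
move=> [[A B] [/= A0 Bv] AB].
have [r /= r0 rA] := A0.
have [n nr] := scalars_archimedean r0.
exists n; apply: (AB (_, v)); split=> /=; last exact: nbhs_singleton.
by apply: rA; rewrite /= sub0r normrN ger0_norm// invr_ge0 ler0n.
Qed.

(** * Splitting the index set where the sequence drops *)

(** The index p is the last one of the block starting at m; its successor
    starts the next block. *)
Lemma quarter_drop {R : realType} {e : nat -> R} (m : nat) :
    (forall n, 0 < e n) -> e @ \oo --> (0 : R) ->
    nonincreasing_seq e ->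
  exists p, [/\ (m <= p)%N, e p.+1 <= e m / 4 &
    forall j, (j <= p)%N -> e m / 4 < e j].
Proof.
move=> e0 ecv edec.
have ex : exists j, e j <= e m / 4.
  have em : 0 < e m / 4 by rewrite divr_gt0.
  have /cvgrPdist_lt/(_ _ em)[j _ /(_ j (leqnn j))] := ecv.
  by rewrite /= sub0r normrN gtr0_norm// => /ltW; exists j.
case: (ex_minnP ex) => p ep minp.
have mp : (m < p)%N.
  rewrite ltnNge; apply/negP => /edec pm; have := e0 m; lra.
exists p.-1; split; first by rewrite -ltnS (ltn_predK mp).
  by rewrite (ltn_predK mp).
move=> j jp; rewrite ltNge; apply/negP => /minp.
by rewrite -(ltn_predK mp) ltnNge jp.
Qed.

Lemma block_index {n : nat -> nat} {j : nat} :
    (forall k, (n k < n k.+1)%N) -> (n 0%N <= j)%N ->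
  exists k, (n k <= j < n k.+1)%N.
Proof.
move=> ninc; elim: j => [|j IH].
  by exists 0%N; rewrite (leq_ltn_trans _ (ninc 0)) ?andbT.
rewrite leq_eqVlt => /orP[/eqP nj|].
  by exists 0%N; rewrite -nj leqnn ninc.
rewrite ltnS => /IH [k /andP[kj jk]].
move: jk; rewrite leq_eqVlt => /orP[/eqP jk|jk].
  by exists k.+1; rewrite -jk leqnn jk ninc.
by exists k; rewrite (leqW kj).
Qed.

(** * Series dominated by a rapidly decreasing sequence *)

(** The drop gives mu k <= 4/3 (mu k - mu (k + 1)), so the F-norms of the terms
    are dominated by a telescoping sequence. *)
Lemma rapid_series_cvg {R : realType} {K : numFieldType}
    {X : topologicalLmodType K} {N : X -> R} {x : nat -> X} {mu : nat -> R} :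
    frechet_space N -> (forall k, 0 <= mu k) ->
    (forall k, mu k.+1 <= mu k / 4) -> mu @ \oo --> (0 : R) ->
    (forall k, N (x k) <= mu k) ->
  exists l, forall k, N (l - \sum_(i < k) x i) <= 4 / 3 * mu k.
Proof.
move=> FN mu0 mudrop mucv xmu; have fN := frechet_fnorm FN.
pose u k := \sum_(i < k) x i.
have tail k m : N (u (k + m)%N - u k) <= 4 / 3 * (mu k - mu (k + m)%N).
  elim: m => [|m IH]; first by rewrite addn0 !subrr mulr0 (fnorm0 fN).
  rewrite addnS /u big_ord_recr/= addrAC.
  apply: (le_trans (fnorm_triangle fN _ _)).
  move: IH (xmu (k + m)%N) (mudrop (k + m)%N); rewrite /u; lra.
have tail_le k j : (k <= j)%N -> N (u j - u k) <= 4 / 3 * mu k.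
  move=> kj; have := tail k (j - k)%N; rewrite subnKC//.
  have := mu0 j; lra.
have [|l ul] := frechet_complete FN (u := u).
  move=> r r0; have r3 : 0 < 3 / 8 * r by rewrite mulr_gt0.
  have /cvgrPdist_lt/(_ _ r3)[m _ /(_ m (leqnn m))] := mucv.
  rewrite /= sub0r normrN ger0_norm// => mr; exists m => i j mi mj.
  rewrite -(subrKA (u m)).
  apply: (le_lt_trans (fnorm_triangle fN _ _)).
  rewrite -(fnormN fN (u m - u j)) opprB.
  have := tail_le _ _ mi; have := tail_le _ _ mj; lra.
exists l => k; apply/ler_addgt0Pr => d d0.
have /ul[m _ um] : nbhs l [set y | N (l - y) < d].
  by apply/(frechet_topology FN); exists d.
have /= lu := um (maxn m k) (leq_maxl _ _).
rewrite -(subrKA (u (maxn m k))).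
apply: (le_trans (fnorm_triangle fN _ _)).
have := tail_le _ _ (leq_maxr m k); lra.
Qed.

(** * A vector with prescribed decay of distances *)

(** The infimum of the deviations may be infinite; passing to a finite positive
    lower bound d removes the extended reals. *)
Lemma deviation_uniform {R : realType} {K : numFieldType} {X : lmodType K}
    {N : X -> R} {V : nat -> set X} :
    (0 < ereal_inf [set deviation N V n | n in [set: nat]])%E ->
  exists2 d : R, 0 < d &
    forall n a, a < d -> exists2 v, V n.+1 v & a < dist N v (V n).
Proof.
set I := ereal_inf _ => I0.
have [d d0 dI] : exists2 d : R, 0 < d & (d%:E <= I)%E.
  case: I I0 => [r| |]//; first by exists r.
  by exists 1; rewrite ?leey.
exists d => // n a ad.
have : (a%:E < deviation N V n)%E.
  apply: (lt_le_trans (_ : (a%:E < d%:E)%E)); first by rewrite lte_fin.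
  by apply: (le_trans dI); apply: ereal_inf_lbound; exists n.
by move=> /ereal_sup_gt[_ [v Vv <-]]; rewrite lte_fin; exists v.
Qed.

Theorem theorem2p9 (R : realType) (k : scalar_kind)
  (X : topologicalLmodType (scalars R k)) (N : X -> R)
  (V : nat -> set X) (e : nat -> R) :
  frechet_space N ->
  infinite_dimensional X ->
  (forall n, submod_closed (mem (V n))) ->
  (forall n, V n `<=` V n.+1) ->
  (forall n, closure (V n) `<=` V n.+1) ->
  closure (\bigcup_n V n) = [set: X] ->
  (forall n, 0 < e n) ->
  nonincreasing_seq e ->
  e @ \oo --> (0 : R) ->
  (0 < ereal_inf [set deviation N V n | n in [set: nat]])%E ->
  exists (n0 : nat) (x : X), forall n, (n0 <= n)%N ->
    e n / 3 <= dist N x (V n) /\ dist N x (V n) <= 3 * e n.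
Proof.
move=> FN _ sV Vinc _ _ epos edec ecv /deviation_uniform[d d0 dev].
have fN := frechet_fnorm FN.
have VO n : V n !=set0 by exists 0; case: (sV n) => V0 _; rewrite inE in V0.
have Vmono m n : (m <= n)%N -> V m `<=` V n.
  by move=> /subnK <-; elim: (n - m)%N => // i IH y /IH /Vinc.
have [n0 en0] : exists n0, e n0 < d.
  have /cvgrPdist_lt/(_ _ d0)[n _ /(_ n (leqnn n))] := ecv.
  by rewrite /= sub0r normrN gtr0_norm//; exists n.
have /choice[last lastP] := fun m => quarter_drop m epos ecv edec.
(* n_ m is the first index of the m-th block and last (n_ m) its last one. *)
pose n_ := fix n_ m := if m is m'.+1 then (last (n_ m')).+1 else n0.
have ninc m : (n_ m < n_ m.+1)%N by have [] := lastP (n_ m).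
have n_ge m : (m <= n_ m)%N.
  by elim: m => // m IH; exact: leq_ltn_trans IH (ninc m).
have n_ge0 m : (n0 <= n_ m)%N.
  by elim: m => // m IH; exact: leq_trans IH (ltnW (ninc m)).
have ex m : exists x, [/\ V (n_ m.+1) x,
    25 / 48 * e (n_ m) <= dist N x (V (last (n_ m))) &
    N x < 27 / 48 * e (n_ m)].
  have := epos (n_ m) => ek; have := edec _ _ (n_ge0 m) => ek0.
  have [|v Vv av] := dev (last (n_ m)) (25 / 48 * e (n_ m)); first lra.
  apply: (near_extremal_vector fN (sV _) (sV _) (@Vinc _) _ _ _ Vv av).
  - by move=> r r0; exact: fnorm_small_multiple.
  - lra.
  - lra.
have /choice[x xP] := ex.
pose mu m := 27 / 48 * e (n_ m).
have mudrop m : mu m.+1 <= mu m / 4.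
  have [_] := lastP (n_ m); rewrite /mu/=; lra.
have mu0 m : 0 <= mu m by rewrite /mu mulr_ge0// ltW.
have mucv : mu @ \oo --> (0 : R).
  apply: (@squeeze_cvgr _ _ _ _ (fun=> 0) e); last 2 first.
  - exact: cvg_cst.
  - exact: ecv.
  apply: nearW => m; rewrite mu0/= /mu.
  have := edec _ _ (n_ge m); have := epos (n_ m); lra.
have [|l lP] := rapid_series_cvg FN mu0 mudrop mucv (x := x).
  by move=> m; have [_ _ /ltW] := xP m.
have Vsum m : V (n_ m) (\sum_(i < m) x i).
  elim: m => [|m IH].
    by rewrite big_ord0; case: (sV (n_ 0%N)) => V0 _; rewrite inE in V0.
  rewrite big_ord_recr/=; have [Vx _ _] := xP m.
  have [_ /(_ 1 (\sum_(i < m) x i) (x m))] := sV (n_ m.+1).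
  rewrite !inE scale1r; apply=> //.
  exact: Vmono (ltnW (ninc m)) _ IH.
exists n0, l => j /(block_index ninc)[m /andP[kj jk]].
have [kp _ /(_ j jk) ej] := lastP (n_ m).
have [_ xk _] := xP m.
have ejk := edec _ _ kj.
split; last first.
  apply: (le_trans (dist_le fN l (Vmono _ _ kj _ (Vsum m)))).
  apply: (le_trans (lP m)); rewrite /mu; lra.
have jp : (j <= last (n_ m))%N by [].
apply: (@le_trans _ _ (dist N l (V (last (n_ m))))); last first.
  by apply: (dist_antitone fN) => //; exact: Vmono.
(* Modulo V (last (n_ m)), the limit l is x m plus the tail after x m. *)
have Vu : V (last (n_ m)) (- \sum_(i < m) x i).
  have [V0 /(_ (-1) (\sum_(i < m) x i) 0)] := sV (last (n_ m)).
  rewrite scaleN1r addr0; rewrite !inE in V0 * => H; apply: H => //.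
  exact: Vmono kp _ (Vsum m).
have := dist_lipschitz_mod fN (x m) l (sV _) Vu.
have := lP m.+1; rewrite big_ord_recr/= opprK (addrC (x m)).
rewrite -(fnormN fN (l - _)) opprB.
have := mudrop m; rewrite /mu; lra.
Qed.
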